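(* For the online multiple one-dimensional knapsack problem with departures described in the context, with instances satisfying Assumptions (A1)–(A3), no online algorithm can achieve a competitive ratio smaller than $\Omega(\ln(\alpha\theta))$, where $\theta=\max_{k\in[K]}\theta_k$ and $\alpha=\max_{k\in[K]}\alpha_k$.
   Context: Online knapsack with departures: there are $K$ knapsacks and a slotted time horizon $[T]=\{1,\dots,T\}$; knapsack $k\in[K]$ has capacity $C_k>0$. Items $n=1,\dots,N$ arrive one by one; item $n$ is described by $\mathcal{I}_n=\{a_n,\{w_{nk},v_{nk},\mathcal{T}_{nk}\}_{k\in[K]}\}$, where $a_n$ is its arrival time and, for knapsack $k$, $w_{nk}>0$ is its (scalar) size, $v_{nk}>0$ its value, and $\mathcal{T}_{nk}=\{s_{nk},\dots,s_{nk}+d_{nk}-1\}$ the set of $d_{nk}$ consecutive time slots it would occupy in knapsack $k$ ($d_{nk}$ is its duration). Upon arrival of item $n$, an online algorithm must irrevocably choose $x_{nk}\in\{0,1\}$, $k\in[K]$, with $\sum_k x_{nk}\le 1$ (all zero means rejection), using only $\mathcal{I}_1,\dots,\mathcal{I}_n$, subject to the capacity constraints $\sum_{n: t\in\mathcal{T}_{nk}} w_{nk}x_{nk}\le C_k$ for all $k\in[K]$, $t\in[T]$. Its value on instance $\mathcal{I}$ is $\mathrm{ALG}(\mathcal{I})=\sum_{n,k}v_{nk}x_{nk}$; $\mathrm{OPT}(\mathcal{I})$ is the optimal value of the same integer program solved offline with full knowledge of $\mathcal{I}$. The competitive ratio is $\max_{\mathcal{I}}\mathrm{OPT}(\mathcal{I})/\mathrm{ALG}(\mathcal{I})$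 over all instances satisfying the assumptions. Assumptions: (A1) $v_{nk}/(w_{nk}d_{nk})\in[1,\theta_k]$ for all $n,k$; (A2) $d_{nk}\in[\underline{D}_k,\overline{D}_k]$ for all $n,k$, and $\alpha_k=\overline{D}_k/\underline{D}_k$; (A3) $w_{nk}\le\varepsilon_k\le C_k$ for all $n,k$. *)

(* Defs.v *)
From mathcomp Require Import all_boot all_order all_algebra.
From mathcomp Require Import all_classical all_reals all_analysis.

Set Implicit Arguments.
Unset Strict Implicit.
Unset Printing Implicit Defensive.

Import Order.TTheory GRing.Theory Num.Theory.
Local Open Scope classical_set_scope.
Local Open Scope ring_scope.

Section OnlineKnapsack.
Variables (R : realType) (K : nat).

(* The data known in advance: everything but the items. *)
Record setup := Setup {
  horizon : nat;             (* T *)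
  capacity : 'I_K -> R;      (* C_k *)
  theta : 'I_K -> R;         (* theta_k *)
  dur_min : 'I_K -> nat;     (* underline D_k *)
  dur_max : 'I_K -> nat;     (* overline D_k *)
  eps : 'I_K -> R            (* epsilon_k *)
}.

(* [dur_max S k <= horizon S] says that every duration allowed in
   knapsack k fits in the horizon. *)
Definition setup_ok (S : setup) : Prop :=
  forall k, [/\ 0 < capacity S k,
                1 <= theta S k,
                (0 < dur_min S k <= dur_max S k)%N,
                (dur_max S k <= horizon S)%N
              & 0 < eps S k <= capacity S k].

Definition alpha (S : setup) (k : 'I_K) : R :=
  (dur_max S k)%:R / (dur_min S k)%:R.

(* The base value 0 of the two maxima is irrelevant when K > 0, since
   setup_ok makes all the entries at least 1. *)
Definition max_theta (S : setup) : R := \big[Num.max/0]_(k < K) theta S k.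
Definition max_alpha (S : setup) : R := \big[Num.max/0]_(k < K) alpha S k.

Record item := Item {
  arrival : nat;             (* a_n *)
  weight : 'I_K -> R;        (* w_nk *)
  value : 'I_K -> R;         (* v_nk *)
  start : 'I_K -> nat;       (* s_nk *)
  duration : 'I_K -> nat     (* d_nk *)
}.

Definition slots (i : item) (k : 'I_K) : seq nat :=
  iota (start i k) (duration i k).

(* Time slots are numbered 1, ..., T; an item arrives no later than its first
   slot, and its slots lie in the horizon. *)
Definition item_ok (S : setup) (i : item) : Prop :=
  (0 < arrival i)%N /\
  forall k,
    [/\ 0 < weight i k, 0 < value i k,
        (arrival i <= start i k)%N &
        forall t, t \in slots i k -> (t <= horizon S)%N] /\
    [/\ 1 <= value i k / (weight i k * (duration i k)%:R) <= theta S k,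
        (dur_min S k <= duration i k <= dur_max S k)%N
      & weight i k <= eps S k].

Definition nth_item (I : seq item) (n : 'I_(size I)) : item :=
  tnth (in_tuple I) n.

Definition instance_ok (S : setup) (I : seq item) : Prop :=
  sorted leq (map arrival I) /\
  forall n : 'I_(size I), item_ok S (nth_item n).

Definition decision := {ffun 'I_K -> bool}.

Definition allocation (I : seq item) := {ffun 'I_(size I) -> decision}.

(* [t : 'I_(horizon S)] stands for the time slot [t.+1]. *)
Definition feasible (S : setup) (I : seq item) (x : allocation I) : bool :=
  [forall n, (\sum_(k < K) x n k <= 1)%N] &&
  [forall k, forall t : 'I_(horizon S),
     \sum_(n < size I | t.+1 \in slots (nth_item n) k)
        weight (nth_item n) k * (x n k)%:R <= capacity S k].

Definition total_value (I : seq item) (x : allocation I) : R :=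
  \sum_(n < size I) \sum_(k < K) value (nth_item n) k * (x n k)%:R.

(* The base value 0 is the value of the all-zero allocation, which is feasible
   as soon as the capacities are nonnegative. *)
Definition OPT (S : setup) (I : seq item) : R :=
  \big[Num.max/0]_(x : allocation I | feasible S x) total_value x.

(* The decision on the n-th item is the value of the algorithm at
   I_1, ..., I_n; earlier decisions are functions of the same list. *)
Definition algorithm := seq item -> decision.

Definition run (A : algorithm) (I : seq item) : allocation I :=
  [ffun n : 'I_(size I) => A (take n.+1 I)].

Definition online_algorithm (S : setup) (A : algorithm) : Prop :=
  forall I, instance_ok S I -> feasible S (run A I).

Definition ALG (A : algorithm) (I : seq item) : R := total_value (run A I).

(* In \bar R, x / 0 = +oo for x > 0, so an algorithm with ALG = 0 < OPT on some
   instance has ratio +oo; 0 / 0 = 0, which occurs for the empty instance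
   only. *)
Definition competitive_ratio (S : setup) (A : algorithm) : \bar R :=
  ereal_sup [set ((OPT S I)%:E / (ALG A I)%:E)%E | I in instance_ok S].

End OnlineKnapsack.

(* Main.v *)
(** Since [ln (alpha * theta) <= 2 * max (ln alpha, ln theta)], it suffices to
    bound the ratio below by a multiple of [ln alpha_k] and of [ln theta_k] for
    each single knapsack [k]. All items occupy slot 1 and are worthless outside
    [k]. They come in batches [j = 0, ..., m], each of which could fill
    knapsack [k], with value [p * 2 ^ j] per unit of weight, the factor [2 ^ j]
    being obtained from the durations (for [alpha_k]) or from the value
    densities (for [theta_k]).  Stopping after batch [q], the optimum is at least
    [C * p * 2 ^ q]; if an algorithm were [x]-competitive, adding these
    inequalities with weights [2 ^ -q] would give [m + 1 <= 4 * x], because the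
    weights of the accepted items add up to at most [C] at slot 1. *)

Require Import Defs.
From mathcomp Require Import all_boot all_order all_algebra.
From mathcomp Require Import all_classical all_reals all_analysis.
From mathcomp Require Import lra.

Import Order.TTheory GRing.Theory Num.Theory.
Local Open Scope ring_scope.

(** * Geometric sums and powers of two *)

Section Arithmetic.
Context {R : realType}.

(** Since [2 ^- q = 2 * 2 ^- q - 2 * 2 ^- q.+1], the sum telescopes, and the bound drops the last
    term. *)
Lemma sum_geometric_tail (a m : nat) :
  \sum_(q < m | (a <= q)%N) (2 ^- q : R) <= 2 * 2 ^- a.
Proof.
have sumE b : \sum_(a <= q < a + b) (2 ^- q : R) = 2 * 2 ^- a - 2 * 2 ^- (a + b).
  elim: b => [|b IHb]; first by rewrite addn0 big_geq // subrr.
  rewrite addnS big_nat_recr ?leq_addr //= IHb exprS invfM mulrA divff // mul1r.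
  lra.
have [ltma|leam] := ltnP m a.
  rewrite big1 ?mulr_ge0 ?invr_ge0 ?exprn_ge0 // => q leaq.
  by have := leq_ltn_trans leaq (ltn_trans (ltn_ord q) ltma); rewrite ltnn.
rewrite -(big_geq_mkord a m xpredT (fun q => 2 ^- q)) -(subnKC leam) sumE gerBl.
by rewrite mulr_ge0 ?invr_ge0 ?exprn_ge0.
Qed.

Lemma dyadic_scale (x : R) : 1 <= x ->
  exists m, 2 ^+ m <= x < 2 ^+ m.+1.
Proof.
move=> x1; have x0 : 0 <= x := le_trans ler01 x1.
have /andP[truncx xtrunc] := truncn_itv x0.
have trunc0 : (0 < Num.trunc x)%N by rewrite truncn_gt0.
have /andP[lb ub] := trunc_log_bounds (isT : (1 < 2)%N) trunc0.
exists (trunc_log 2 (Num.trunc x)); rewrite -!natrX; apply/andP; split.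
  by apply: le_trans truncx; rewrite ler_nat.
by apply: lt_le_trans xtrunc _; rewrite ler_nat.
Qed.

Lemma exp2_le_expR n : 2 ^+ n <= expR n%:R :> R.
Proof.
rewrite -[n%:R]mulr1 expRM_natl lerXn2r ?nnegrE ?expR_ge0 //.
by have := expR_ge1Dx (1 : R).
Qed.

(* The [q]-th hypothesis is weighted by [2 ^- q], so that every unit of
   capacity [z n] contributes at most [2] to the weighted sum. *)
Lemma dyadic_fill_bound {m M : nat} {g : nat -> nat} {z : nat -> R} {C x : R} :
  0 < C -> 0 <= x -> (forall n, 0 <= z n) -> \sum_(n < M) z n <= C ->
  (forall q, (q <= m)%N ->
     C * 2 ^+ q <= x * (\sum_(n < M | (g n <= q)%N) z n * 2 ^+ g n + C)) ->
  m.+1%:R <= 4 * x.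
Proof.
move=> C0 x0 z0 zC fill.
have e0 q : 0 < 2 ^+ q :> R by rewrite exprn_gt0.
have : \sum_(q < m.+1) C <=
    \sum_(q < m.+1) x * (\sum_(n < M | (g n <= q)%N) z n * 2 ^+ g n + C) * 2 ^- q.
  apply: ler_sum => q _; rewrite ler_pdivlMr //.
  exact: fill (ltn_ord q).
rewrite sumr_const card_ord -[C *+ _]mulr_natl => h.
rewrite -(ler_pM2r C0); apply: le_trans h _.
under eq_bigr do rewrite -mulrA mulrDl mulrDr.
rewrite big_split /= -!mulr_sumr -mulrDr.
(* The part [2 * C] bounds the contribution of the [z n]; the part [C * 2] bounds that of the
   additive [C]. *)
have -> : 4 * x * C = x * (2 * C + C * 2) by lra.
apply: ler_wpM2l => //; apply: lerD; last first.
  rewrite ler_pM2l //; apply: le_trans (sum_geometric_tail 0 m.+1) _.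
  by rewrite expr0 invr1 mulr1.
under eq_bigr do rewrite mulr_suml big_mkcond.
(* For fixed [n], the indices [q >= g n] form a geometric tail that cancels the factor [2 ^+ g n] up
   to 2. *)
rewrite exchange_big /=.
apply: (@le_trans _ _ (\sum_(n < M) 2 * z n)); last first.
  by rewrite -mulr_sumr ler_wpM2l.
apply: ler_sum => n _; rewrite -big_mkcond /=.
rewrite -mulr_sumr; apply: le_trans (ler_wpM2l _ (sum_geometric_tail _ _)) _.
  by rewrite mulr_ge0 // ltW.
by rewrite mulrCA -mulrA divff ?mulr1 // gt_eqF.
Qed.

End Arithmetic.

(** * The competitive ratio, and instances cut from one sequence of items *)

Section Competitive.
Context {R : realType} {K : nat}.
Implicit Types (S : setup R K) (A : algorithm R K) (it : nat -> item R K).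

Lemma ALG_ge0 S A I : instance_ok S I -> 0 <= ALG A I.
Proof.
case=> _ okI; apply: sumr_ge0 => n _; apply: sumr_ge0 => k _.
have [_ /(_ k)[[_ v0 _ _] _]] := okI n.
by rewrite mulr_ge0 ?ler0n // ltW.
Qed.

(** If [ALG A I] is 0, the quotient is +oo unless [OPT S I] is 0 too, and a ratio below a real
    number excludes +oo. *)
Lemma OPT_le_ratio_ALG S A I (x : R) : instance_ok S I ->
  (competitive_ratio S A < x%:E)%E -> OPT S I <= x * ALG A I.
Proof.
move=> okI; set r := (X in (X < _)%E) => ltx.
have : ((OPT S I)%:E / (ALG A I)%:E <= r)%E.
  by apply: ereal_sup_ubound; exists I.
move/le_lt_trans/(_ ltx); rewrite inver.
have OPT0 : 0 <= OPT S I by exact: bigmax_ge_id.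
case: eqVneq => [-> | ALGn0].
  rewrite mulr0; move: OPT0; rewrite le_eqVlt => /predU1P[<- // | OPT0].
  by rewrite gt0_muley ?lte_fin.
rewrite -EFinM lte_fin ltr_pdivrMr; first exact: ltW.
by rewrite lt_neqAle eq_sym ALGn0 (@ALG_ge0 S).
Qed.

Lemma nth_item_mkseq it L (n : 'I_(size (mkseq it L))) : nth_item n = it n.
Proof.
have := ltn_ord n; rewrite /nth_item (tnth_nth (it 0)) /= {2}size_mkseq => ltnL.
by rewrite nth_mkseq.
Qed.

Lemma sum_mkseq {it L} {P : item R K -> nat -> bool} {F : item R K -> nat -> R} :
  \sum_(n < size (mkseq it L) | P (nth_item n) n) F (nth_item n) n =
  \sum_(n < L | P (it n) n) F (it n) n.
Proof.
rewrite -(big_mkord (fun n => P (it n) n) (fun n => F (it n) n)).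
rewrite -[in RHS](size_mkseq it L) big_mkord.
by apply: eq_big => [n | n _]; rewrite nth_item_mkseq.
Qed.

(** The decision on item [n] sees only a prefix, so it does not depend on [L]: the adversary can
    stop anywhere without changing earlier decisions. *)
Lemma run_mkseq A it L (n : 'I_(size (mkseq it L))) :
  run A (mkseq it L) n = A (mkseq it n.+1).
Proof.
have := ltn_ord n; rewrite {2}size_mkseq => ltnL.
by rewrite ffunE /mkseq -map_take take_iota (minn_idPl ltnL).
Qed.

Lemma ALG_mkseq A it L : ALG A (mkseq it L) =
  \sum_(n < L) \sum_(k < K) value (it n) k * (A (mkseq it n.+1) k)%:R.
Proof.
rewrite -(@sum_mkseq _ _ (fun _ _ => true)
  (fun i n => \sum_(k < K) value i k * (A (mkseq it n.+1) k)%:R)).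
by apply: eq_bigr => n _; apply: eq_bigr => k _; rewrite run_mkseq.
Qed.

Lemma online_load_le S A it L k t :
  online_algorithm S A -> instance_ok S (mkseq it L) -> (t < horizon S)%N ->
  \sum_(n < L | t.+1 \in slots (it n) k)
     weight (it n) k * (A (mkseq it n.+1) k)%:R <= capacity S k.
Proof.
move=> onA okI ltt; have /andP[_ /forallP/(_ k)/forallP/(_ (Ordinal ltt))] := onA _ okI.
rewrite -(@sum_mkseq _ _ (fun i _ => t.+1 \in slots i k)
  (fun i n => weight i k * (A (mkseq it n.+1) k)%:R)).
by under eq_bigr do rewrite run_mkseq.
Qed.

Lemma instance_ok_mkseq S it L : (forall n, arrival (it n) = 1%N) ->
  (forall n, (n < L)%N -> item_ok S (it n)) -> instance_ok S (mkseq it L).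
Proof.
move=> arr1 okit; split=> [|n].
  rewrite -map_comp (eq_map (arr1 : _ \o _ =1 fun=> 1%N)).
  by elim: (iota 0 L) => //= a [].
by rewrite nth_item_mkseq; apply: okit; have := ltn_ord n; rewrite {2}size_mkseq.
Qed.

(** Accepting exactly the items in [P], all into knapsack [k], is feasible: no slot carries more
    than their total weight. *)
Lemma OPT_mkseq_ge S it L k (P : pred nat) : setup_ok S ->
  (forall n, (n < L)%N -> 0 <= weight (it n) k) ->
  \sum_(n < L | P n) weight (it n) k <= capacity S k ->
  \sum_(n < L | P n) value (it n) k <= OPT S (mkseq it L).
Proof.
move=> okS w0 fits.
pose x : allocation (mkseq it L) := 
    [ffun n : 'I_(size (mkseq it L)) => [ffun k' => (k' == k) && P n]].
have -> : \sum_(n < L | P n) value (it n) k = total_value x.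
  rewrite -(@sum_mkseq _ _ (fun _ n => P n) (fun i _ => value i k)) big_mkcond.
  apply: eq_bigr => n _; rewrite (bigD1 k) //= big1 => [|k' k'k].
    by rewrite !ffunE eqxx addr0; case: (P n); rewrite ?mulr1 ?mulr0.
  by rewrite !ffunE (negPf k'k) mulr0.
apply: (le_bigmax_cond 0 (@total_value R K _)).
apply/andP; split.
  apply/forallP => n; rewrite (bigD1 k) //= big1 => [|k' k'k].
    by rewrite addn0 leq_b1.
  by rewrite !ffunE (negPf k'k).
apply/forallP => k'; apply/forallP => t.
have [-> | k'k] := eqVneq k' k; last first.
  rewrite big1 => [|n _]; last by rewrite !ffunE (negPf k'k) mulr0.
  by have [/ltW] := okS k'.
apply: le_trans fits.
rewrite -(@sum_mkseq _ _ (fun _ n => P n) (fun i _ => weight i k)).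
rewrite big_mkcond [leRHS]big_mkcond; apply: ler_sum => n _.
have wn0 : 0 <= weight (nth_item n) k.
  by rewrite nth_item_mkseq w0 //; have := ltn_ord n; rewrite {2}size_mkseq.
rewrite !ffunE eqxx /=.
by case: ifP => _; case: (P n); rewrite ?mulr1 ?mulr0.
Qed.

End Competitive.

(** * The adversarial batches aimed at one knapsack *)

Section Adversary.
Context {R : realType} {K : nat}.

(* With [u] tiny, such an item is worth almost nothing outside knapsack [k],
   which reduces the lower bound to that single knapsack. *)
Definition focused_item (S : setup R K) (k : 'I_K) (w : R) (u : 'I_K -> R)
    (r : R) (d : nat) : item R K :=
  Item 1 (fun k' => if k' == k then w else u k')
    (fun k' => if k' == k then w * (r * d%:R) else u k' * (dur_min S k')%:R)
    (fun _ => 1%N) (fun k' => if k' == k then d else dur_min S k').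

Lemma focused_item_ok S k w u r d : setup_ok S ->
  0 < w <= eps S k -> (forall k', 0 < u k' <= eps S k') ->
  1 <= r <= theta S k -> (dur_min S k <= d <= dur_max S k)%N ->
  item_ok S (focused_item S k w u r d).
Proof.
move=> okS /andP[w0 wk] ubnd /andP[r1 rk] /andP[dmin dmax]; split=> // k'.
have [_ th1 /andP[Dmin0 Dle] DT _] := okS k'.
have /andP[u0 uk] := ubnd k'.
rewrite /slots /=; case: eqVneq => [kk | _].
  subst k'; have d0 : 0 < d%:R :> R by rewrite ltr0n (leq_trans Dmin0).
  have r0 : 0 < r by apply: lt_le_trans r1.
  split; split => //; rewrite ?mulr_gt0 //.
  - move=> t; rewrite mem_iota add1n ltnS => /andP[_ tle].
    exact: leq_trans tle (leq_trans dmax DT).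
  - by rewrite mulrCA mulfK ?gt_eqF ?mulr_gt0 // r1.
  - by rewrite dmin.
have d0 : 0 < (dur_min S k')%:R :> R by rewrite ltr0n.
split; split => //; rewrite ?mulr_gt0 //.
- move=> t; rewrite mem_iota add1n ltnS => /andP[_ tle].
  exact: leq_trans tle (leq_trans Dle DT).
- by rewrite divff ?lexx ?gt_eqF ?mulr_gt0.
- by rewrite leqnn.
Qed.

(** Batch [j] has density [r j] and duration [d j]. Only the product has to double, so one argument
    serves both growing densities and growing durations. *)
Lemma flooding_bound (S : setup R K) (A : algorithm R K) k m (d : nat -> nat) (r : nat -> R) (x : R) :
  setup_ok S -> online_algorithm S A ->
  (forall I, instance_ok S I -> OPT S I <= x * ALG A I) ->
  (forall j, (j <= m)%N -> 1 <= r j <= theta S k) ->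
  (forall j, (j <= m)%N -> (dur_min S k <= d j <= dur_max S k)%N) ->
  (forall j, (j <= m)%N -> r j * (d j)%:R = r 0 * (d 0)%:R * 2 ^+ j) ->
  m.+1%:R <= 4 * x.
Proof.
move=> okS onA optA rbnd dbnd rdE.
have [C0 th1 /andP[Dmin0 Dle] DT /andP[eps0 epsC]] := okS k.
set C := capacity S k in C0 epsC.
set p := r 0 * (d 0)%:R in rdE.
have p0 : 0 < p.
  have /andP[r1 _] := rbnd 0 isT; have /andP[dm _] := dbnd 0 isT.
  by rewrite mulr_gt0 ?ltr0n ?(leq_trans Dmin0) // (lt_le_trans _ r1).
clearbody p.
(* With this rounding, [N] items of weight [w = C / N] fill the capacity exactly, and [w] is at most
   [eps S k]. *)
pose N := (Num.trunc (C / eps S k)).+1.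
have N0 : 0 < N%:R :> R by rewrite ltr0n.
pose w := C / N%:R.
have w0 : 0 < w by rewrite divr_gt0.
have weps : w <= eps S k.
  rewrite ler_pdivrMr // mulrC -ler_pdivrMr //.
  by have /truncn_itv/andP[_ /ltW] : 0 <= C / eps S k by rewrite divr_ge0 // ltW.
pose M := (N * m.+1)%N.
have M0 : 0 < M%:R :> R by rewrite ltr0n muln_gt0.
have K0 : 0 < K%:R :> R by rewrite ltr0n (leq_trans _ (ltn_ord k)).
have D0 k' : 0 < (dur_min S k')%:R :> R.
  by have [_ _ /andP[? _] _ _] := okS k'; rewrite ltr0n.
(* The quotient is chosen so that [M] items over [K] knapsacks yield at most [C * p] outside [k]. *)
pose u k' := Num.min (eps S k') (C * p / (M%:R * K%:R * (dur_min S k')%:R)).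
have ubnd k' : 0 < u k' <= eps S k'.
  have [_ _ _ _ /andP[e0 _]] := okS k'.
  by rewrite /u lt_min e0 ge_min lexx andbT divr_gt0 ?mulr_gt0.
have uval k' : u k' * (dur_min S k')%:R <= C * p / (M%:R * K%:R).
  rewrite -ler_pdivlMr // /u ge_min; apply/orP; right.
  by rewrite [(_ * (dur_min S k')%:R)^-1]invfM mulrA.
pose it n := focused_item S k w u (r (n %/ N)%N) (d (n %/ N)%N).
have okit n : (n < M)%N -> item_ok S (it n).
  rewrite /M mulnC -ltn_divLR // ltnS => nm.
  by apply: focused_item_ok; rewrite ?w0 ?rbnd ?dbnd.
have leM q : (q <= m)%N -> (N * q.+1 <= M)%N by move=> qm; rewrite leq_mul2l ltnS qm orbT.
have okI q : (q <= m)%N -> instance_ok S (mkseq it (N * q.+1)).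
  move=> qm; apply: instance_ok_mkseq => // n nq.
  exact/okit/(leq_trans nq)/leM.
have inq q (n : 'I_M) : (n < N * q.+1)%N = (n %/ N <= q)%N.
  by rewrite mulnC -ltn_divLR.
pose y n : R := (A (mkseq it n.+1) k)%:R.
(* Offline, batch [q] alone is accepted. *)
have optq q : (q <= m)%N -> C * p * 2 ^+ q <= OPT S (mkseq it (N * q.+1)).
  move=> qm.
  have cardq (e : R) : \sum_(n < N * q.+1 | (n %/ N == q)%N) e = N%:R * e.
    rewrite -(big_mkord (fun n => n %/ N == q)%N (fun=> e)).
    rewrite (@big_cat_nat _ _ _ (N * q)) ?leq_mul2l ?leqnSn ?orbT //=.
    rewrite big_nat_cond big_pred0 ?add0r; last first.
      move=> n; apply/negP => /andP[/andP[_ nq] /eqP nE].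
      by move: nq; rewrite mulnC -ltn_divLR // nE ltnn.
    rewrite big_nat_cond (eq_bigl (fun n => (N * q <= n < N * q.+1)%N)); last first.
      move=> n; case: (boolP (_ <= n < _)%N) => //= /andP[nq nq1].
      by rewrite eqn_leq leq_divRL // -ltnS ltn_divLR // mulnC nq1 mulnC.
    by rewrite -big_nat sumr_const_nat mulnS addnK mulr_natl.
  have := @OPT_mkseq_ge _ _ S it (N * q.+1) k (fun n => n %/ N == q)%N okS.
  rewrite /= eqxx cardq /w [N%:R * _]mulrC divfK ?gt_eqF //.
  move/(_ (fun _ _ => ltW w0) (lexx _)); apply: le_trans.
  rewrite (eq_bigr (fun=> w * (p * 2 ^+ q))) ?cardq.
    by rewrite mulrA [N%:R * _]mulrC divfK ?gt_eqF // mulrA.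
  by move=> n /eqP ->; rewrite rdE.
(* The additive [C], scaled by [p], covers all value collected outside knapsack [k]. *)
have algq q : (q <= m)%N -> ALG A (mkseq it (N * q.+1)) <=
    p * (\sum_(n < M | (n %/ N <= q)%N) w * y n * 2 ^+ (n %/ N)%N + C).
  move=> qm; rewrite ALG_mkseq.
  apply: (@le_trans _ _ (\sum_(n < N * q.+1)
      (p * (w * y n * 2 ^+ (n %/ N)%N) + C * p / M%:R))).
    apply: ler_sum => n _; rewrite (bigD1 k) //=; apply: lerD.
      have nq : (n %/ N <= q)%N by rewrite -ltnS ltn_divLR // [(q.+1 * N)%N]mulnC.
      rewrite eqxx rdE ?(leq_trans nq) //.
      by rewrite mulrAC mulrCA.
    apply: (@le_trans _ _ (\sum_(k' < K) C * p / (M%:R * K%:R))); last first.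
      by rewrite sumr_const card_ord -[leLHS]mulr_natr invfM mulrA divfK ?gt_eqF.
    rewrite big_mkcond; apply: ler_sum => k' _.
    have B0 : 0 <= C * p / (M%:R * K%:R) by rewrite divr_ge0 ?mulr_ge0 // ltW.
    case: eqVneq => //= _; case: (A _ _); by rewrite ?mulr1 ?mulr0.
  rewrite big_split /= mulrDr; apply: lerD.
    rewrite -mulr_sumr ler_pM2l //.
    rewrite (big_ord_widen M (fun n => w * y n * 2 ^+ (n %/ N)%N) (leM q qm)).
    by rewrite (eq_bigl _ _ (inq q)).
  rewrite sumr_const card_ord -[leLHS]mulr_natr [p * C]mulrC -[leLHS]mulrA.
  rewrite ger_pMr ?mulr_gt0 // mulrC ler_pdivrMr // mul1r ler_nat.
  exact: leM.
(* The sign of [x] is read off from the first batch, where the optimum is positive. *)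
have x0 : 0 <= x.
  have opt0 : 0 < OPT S (mkseq it (N * 1)).
    by apply: lt_le_trans (optq 0 isT); rewrite !mulr_gt0.
  have := lt_le_trans opt0 (optA _ (okI 0 isT)).
  have := ALG_ge0 S A _ (okI 0 isT).
  rewrite le_eqVlt => /predU1P[<-|ALG0]; first by rewrite mulr0 ltxx.
  by rewrite pmulr_lgt0 // => /ltW.
apply: (@dyadic_fill_bound _ m M (fun n => n %/ N)%N (fun n => w * y n) C x) => //.
- by move=> n; rewrite mulr_ge0 ?ler0n // ltW.
- have T0 := leq_trans Dmin0 (leq_trans Dle DT).
  (* Index 0 denotes slot 1, which every item occupies, so all accepted weights share one
     capacity. *)
  have := @online_load_le _ _ S A it M k 0 onA (okI m (leqnn m)) T0.
  rewrite (eq_bigl xpredT) => [|n]; first by under eq_bigr do rewrite /= eqxx.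
  rewrite mem_iota /= eqxx add1n ltnS.
  have /dbnd/andP[dm _] : (n %/ N <= m)%N.
    by rewrite -ltnS ltn_divLR // [(m.+1 * N)%N]mulnC.
  exact: leq_trans dm.
move=> q qm; rewrite -(ler_pM2l p0) mulrA [p * C]mulrC.
apply: le_trans (optq q qm) (le_trans (optA _ (okI q qm)) _).
by rewrite mulrCA ler_wpM2l // algq.
Qed.

End Adversary.

(** * Combination of the bounds over all knapsacks *)

Theorem theorem2 (R : realType) :
  exists2 c : R, 0 < c &
    forall (K : nat) (S : setup R K) (A : algorithm R K),
      (0 < K)%N -> setup_ok S -> online_algorithm S A ->
      ((c * ln (max_alpha S * max_theta S))%:E <= competitive_ratio S A)%E.
Proof.
(* The maxima of [alpha] and [theta] are each at most [expR (4 * x)], hence [L <= 8 * x]; taking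
   [x = L / 16] leaves [L <= L / 2], absurd once [L] is positive. *)
exists 16^-1 => [|K S A Kgt0 okS onA]; first by rewrite invr_gt0.
set L := ln _; rewrite leNgt; apply/negP => ltx.
set x := 16^-1 * L in ltx.
have optA I : instance_ok S I -> OPT S I <= x * ALG A I.
  by move=> okI; exact: OPT_le_ratio_ALG ltx.
have scale_le z m : z < 2 ^+ m.+1 -> m.+1%:R <= 4 * x -> z <= expR (4 * x).
  move=> zlt mx; apply: le_trans (ltW zlt) (le_trans (exp2_le_expR _) _).
  by rewrite ler_expR.
(* Densities [2 ^+ j] at the shortest duration, up to the dyadic scale of [theta S k]. *)
have theta_le k : theta S k <= expR (4 * x).
  have [_ th1 /andP[_ Dle] _ _] := okS k.
  have [m /andP[lb ub]] := dyadic_scale _ th1.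
  apply: (scale_le _ m ub).
  apply: (@flooding_bound _ _ S A k m (fun=> dur_min S k) (fun j => 2 ^+ j)) => //.
  - move=> j jm; rewrite exprn_ege1 ?ler1n //=.
    by apply: le_trans lb; rewrite ler_weXn2l ?ler1n.
  - by rewrite leqnn.
  - by move=> j _; rewrite expr0 mul1r mulrC.
(* Here the density stays 1 and the durations double, starting from [dur_min S k]. *)
have alpha_le k : alpha S k <= expR (4 * x).
  have [_ th1 /andP[Dmin0 Dle] _ _] := okS k.
  have D0 : 0 < (dur_min S k)%:R :> R by rewrite ltr0n.
  have al1 : 1 <= alpha S k by rewrite ler_pdivlMr // mul1r ler_nat.
  have [m /andP[lb ub]] := dyadic_scale _ al1.
  apply: (scale_le _ m ub).
  apply: (@flooding_bound _ _ S A k m (fun j => dur_min S k * 2 ^ j)%N (fun=> 1)) => //.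
  - by rewrite lexx.
  - move=> j jm; rewrite leq_pmulr ?expn_gt0 //=.
    move: lb; rewrite ler_pdivlMr // -natrX -natrM ler_nat; apply: leq_trans.
    by rewrite mulnC leq_mul2r leq_exp2l // jm orbT.
  - by move=> j _; rewrite !mul1r expn0 muln1 natrM natrX.
pose k0 := Ordinal Kgt0.
have th0 : 0 < max_theta S.
  have [_ th1 _ _ _] := okS k0.
  by apply: lt_le_trans (lt_le_trans ltr01 th1) (le_bigmax_cond 0 (theta S) _).
have al0 : 0 < max_alpha S.
  have [_ _ /andP[Dmin0 Dle] _ _] := okS k0.
  apply: (@lt_le_trans _ _ (alpha S k0)); last exact: le_bigmax_cond.
  by rewrite divr_gt0 ?ltr0n // (leq_trans Dmin0).
have L8 : L <= 8 * x.
  rewrite -[8 * x](expRK _) ler_ln ?posrE ?mulr_gt0 ?expR_gt0 //.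
  have -> : 8 * x = 4 * x + 4 * x by lra.
  rewrite expRD ler_pM ?(ltW th0) ?(ltW al0) //.
    by apply: bigmax_le => [|k _]; rewrite ?expR_ge0 ?alpha_le.
  by apply: bigmax_le => [|k _]; rewrite ?expR_ge0 ?theta_le.
(* [L] is 0 when both maxima are 1, so positivity is derived separately, from a single batch
   ([m = 0]). *)
have x_gt0 : 0 < x.
  suff : 1%:R <= 4 * x by lra.
  have [_ th1 /andP[_ Dle] _ _] := okS k0.
  apply: (@flooding_bound _ _ S A k0 0 (fun=> dur_min S k0) (fun=> 1)) => //.
  - by rewrite lexx.
  - by rewrite leqnn.
  - by move=> j; rewrite leqn0 => /eqP ->; rewrite expr0 mulr1.
by move: L8 x_gt0; rewrite /x; lra.
Qed.
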